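(* Let $\mathcal{C}$ be a category with a faithful functor $Q:\mathcal{C}\to Set$ satisfying the following condition for every two objects $A$ and $B$ of $\mathcal{C}$: if $Q(A)$ and $Q(B)$ have the same cardinality, then for every bijection $u:Q(A)\to Q(B)$ there exist a unique object $C$ of $\mathcal{C}$ and an isomorphism $u^*:C\to B$ such that $Q(C)=Q(A)$ and $Q(u^* )=u$. Let $\pi:\mathcal{C}\to\mathcal{C}$ be an autoequivalence. If for every object $A$ of $\mathcal{C}$ there exists a bijection $u_A:Q(A)\to Q(\pi(A))$ such that for every morphism $f:A\to B$ of $\mathcal{C}$ the square formed by $u_A:Q(A)\to Q(\pi(A))$, $Q(f):Q(A)\to Q(B)$, $Q(\pi(f)):Q(\pi(A))\to Q(\pi(B))$ and $u_B:Q(B)\to Q(\pi(B))$ commutes, i.e. $Q(\pi(f))\circ u_A=u_B\circ Q(f)$, then $\pi$ is isomorphic (as a functor) to an automorphism $F$ of $\mathcal{C}$.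
   Context: $Set$ is the category of all sets and maps. An autoequivalence of $\mathcal{C}$ is a functor $\mathcal{C}\to\mathcal{C}$ that is full and faithful and such that every object of $\mathcal{C}$ is isomorphic to an object in its image. An automorphism of $\mathcal{C}$ is a functor $\mathcal{C}\to\mathcal{C}$ having a two-sided inverse functor (strictly). Two functors are isomorphic if there is a natural isomorphism between them. *)

(* Defs.v *)
From mathcomp Require Import ssreflect ssrfun ssrbool.

Set Implicit Arguments.
Unset Strict Implicit.
Unset Printing Implicit Defensive.

(* Equality of objects is Leibniz equality, since strict equality of objects
   matters below; [comp g f] is "g after f". *)
Record category := Category {
  ob :> Type;
  hom : ob -> ob -> Type;
  idmap : forall A, hom A A;
  comp : forall A B C, hom B C -> hom A B -> hom A C;
  comp_idl : forall A B (f : hom A B), comp (idmap B) f = f;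
  comp_idr : forall A B (f : hom A B), comp f (idmap A) = f;
  comp_assoc : forall A B C D (h : hom C D) (g : hom B C) (f : hom A B),
    comp h (comp g f) = comp (comp h g) f
}.
Arguments hom {c} A B.
Arguments idmap {c} A.
Arguments comp {c A B C} g f.

Definition is_iso (C : category) (A B : C) (f : hom A B) : Prop :=
  exists g : hom B A, comp g f = idmap A /\ comp f g = idmap B.

(* The types of a fixed universe, playing the role of sets. *)
Definition Sets : category :=
  @Category Type (fun X Y => X -> Y) (fun X => @id X)
    (fun X Y Z (g : Y -> Z) (f : X -> Y) => fun x => g (f x))
    (fun X Y f => erefl f) (fun X Y f => erefl f)
    (fun W X Y Z h g f => erefl (fun x => h (g (f x)))).

Record functor (C D : category) := Functor {
  fob :> C -> D;
  fmap : forall A B : C, hom A B -> hom (fob A) (fob B);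
  fmap_id : forall A : C, fmap (idmap A) = idmap (fob A);
  fmap_comp : forall (A B E : C) (g : hom B E) (f : hom A B),
    fmap (comp g f) = comp (fmap g) (fmap f)
}.
Arguments fmap {C D} f {A B} _ : rename.

Definition id_functor (C : category) : functor C C :=
  @Functor C C (fun A => A) (fun A B f => f)
    (fun A => erefl (idmap A)) (fun A B E g f => erefl (comp g f)).

Definition comp_functor (C D E : category) (G : functor D E) (F : functor C D) :
  functor C E :=
  @Functor C E (fun A => G (F A)) (fun A B f => fmap G (fmap F f))
    (fun A => etrans (congr1 (fun h => fmap G h) (fmap_id F A))
                     (fmap_id G (F A)))
    (fun A B K g f => etrans (congr1 (fun h => fmap G h) (fmap_comp F g f))
                             (fmap_comp G (fmap F g) (fmap F f))).

Definition faithful (C D : category) (F : functor C D) : Prop :=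
  forall (A B : C) (f g : hom A B), fmap F f = fmap F g -> f = g.

Definition full (C D : category) (F : functor C D) : Prop :=
  forall (A B : C) (h : hom (F A) (F B)), exists f : hom A B, fmap F f = h.

Definition essentially_surjective (C D : category) (F : functor C D) : Prop :=
  forall B : D, exists (A : C) (f : hom (F A) B), is_iso f.

Definition is_autoequivalence (C : category) (F : functor C C) : Prop :=
  [/\ full F, faithful F & essentially_surjective F].

(* The equations are strict equalities of functors, not natural isomorphisms. *)
Definition is_automorphism (C : category) (F : functor C C) : Prop :=
  exists G : functor C C,
    comp_functor G F = id_functor C /\ comp_functor F G = id_functor C.

Definition isomorphic_functors (C D : category) (F G : functor C D) : Prop :=
  exists eta : forall A : C, hom (F A) (G A),
    (forall A : C, is_iso (eta A)) /\
    (forall (A B : C) (f : hom A B),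
       comp (fmap G f) (eta A) = comp (eta B) (fmap F f)).

Definition same_cardinality (X Y : Type) : Prop :=
  exists u : X -> Y, bijective u.

(* The statement "Q(C) = Q(A) and Q(v) = u" for v : C -> B: the equation
   Q(v) = u only typechecks after transport along an equality Q(C) = Q(A). *)
Definition lifts (C : category) (Q : functor C Sets) (A B : C)
    (u : Q A -> Q B) (C' : C) (v : hom C' B) : Prop :=
  exists e : Q C' = Q A, ecast X (X -> Q B) e (fmap Q v) = u.

(* "There exist a unique C and an isomorphism ..." is read as: C is the unique
   object admitting such an isomorphism.  (When Q is faithful the isomorphism is
   then unique as well.) *)
Definition lifts_bijections (C : category) (Q : functor C Sets) : Prop :=
  forall A B : C, same_cardinality (Q A) (Q B) ->
  forall u : Q A -> Q B, bijective u ->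
  exists! C' : C, exists v : hom C' B, is_iso v /\ lifts u v.

(* Main.v *)
Require Import Defs.
From mathcomp Require Import ssreflect ssrfun ssrbool.
From Stdlib Require Import FunctionalExtensionality ProofIrrelevance.
From Stdlib Require Import IndefiniteDescription.

(** Transport the structure of [pi A] along the bijection [u A]: the hypothesis
    on [Q] provides an object [F A] with the same underlying set as [A] and an
    isomorphism [v A : F A -> pi A] lying over [u A].  Conjugating [pi] by the
    [v A] turns [F] into a functor isomorphic to [pi]
    ([conjugate_functor]), hence again full, faithful and essentially
    surjective.  Commutation of the squares for [u] says exactly that [F f] has
    the same underlying map as [f].

    Uniqueness in the hypothesis on [Q] makes [Q] rigid: an isomorphism whose
    underlying map is an identity can only join equal objects
    ([eq_of_iso_over_identity]).  This upgrades the equivalence [F] to a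
    bijection on objects.  If [F A = F B], the identity morphism between them
    is [F f] for some isomorphism [f : A -> B], which lies over an identity, so
    that [A = B] ([over_identity_injective]).  If [w : F A -> B] is an
    isomorphism, relabelling the elements of [A] by those of [B] gives an
    object [A'] over the set [Q B] with an isomorphism [c : A' -> A], and
    [w] composed with [F c] is an isomorphism [F A' -> B] over an identity, so
    that [F A' = B] ([over_identity_surjective]).

    Finally a full and faithful functor which is bijective on objects has a
    strict inverse ([automorphism_of_bijective_on_objects]).

    Equality of underlying sets is an equality of types, so that identity maps
    appear as the transports [cast e]; strict equality of functors likewise
    compares morphisms through the morphisms [hom_of_eq p]. *)

Set Implicit Arguments.
Unset Strict Implicit.
Unset Printing Implicit Defensive.

Local Notation "g • f" := (Defs.comp g f) (at level 40, left associativity).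

Lemma dependent_functional_choice (A : Type) (B : A -> Type)
    (P : forall a, B a -> Prop) :
  (forall a, exists b : B a, P a b) ->
  exists f : forall a, B a, forall a, P a (f a).
Proof.
move=> exB; exists (fun a =>
  proj1_sig (constructive_indefinite_description _ (exB a))).
by move=> a; apply: proj2_sig.
Qed.

(** * Isomorphisms *)

Lemma is_iso_id (C : category) (A : C) : is_iso (idmap A).
Proof. by exists (idmap A); rewrite comp_idl. Qed.

Lemma is_iso_comp (C : category) (A B D : C) (g : hom B D) (f : hom A B) :
  is_iso g -> is_iso f -> is_iso (g • f).
Proof.
move=> [g' [g'g gg']] [f' [f'f ff']]; exists (f' • g'); split.
  by rewrite -comp_assoc (comp_assoc g') g'g comp_idl.
by rewrite -comp_assoc (comp_assoc f) ff' comp_idl.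
Qed.

Lemma is_iso_fmap (C D : category) (F : functor C D) (A B : C) (f : hom A B) :
  is_iso f -> is_iso (fmap F f).
Proof.
move=> [f' [f'f ff']]; exists (fmap F f').
by rewrite -!fmap_comp f'f ff' !fmap_id.
Qed.

Lemma is_iso_reflect (C D : category) (F : functor C D) (A B : C) (f : hom A B) :
  full F -> faithful F -> is_iso (fmap F f) -> is_iso f.
Proof.
move=> fullF faithF [g' [g'f fg']]; have [g Fg] := fullF _ _ g'.
by exists g; split; apply: faithF; rewrite fmap_comp Fg fmap_id.
Qed.

(** * Strict equality of functors *)

Definition hom_of_eq (C : category) (A B : C) (p : A = B) : hom A B :=
  ecast X (hom A X) p (idmap A).

Lemma hom_of_eqK (C : category) (A B : C) (p : A = B) :
  hom_of_eq (esym p) • hom_of_eq p = idmap A.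
Proof. by case: B / p; apply: comp_idl. Qed.

Lemma hom_of_eqVK (C : category) (A B : C) (p : A = B) :
  hom_of_eq p • hom_of_eq (esym p) = idmap B.
Proof. by case: B / p; apply: comp_idl. Qed.

Lemma is_iso_hom_of_eq (C : category) (A B : C) (p : A = B) :
  is_iso (hom_of_eq p).
Proof. by exists (hom_of_eq (esym p)); rewrite hom_of_eqK hom_of_eqVK. Qed.

Lemma fmap_hom_of_eq (C D : category) (F : functor C D) (A B : C) (p : A = B) :
  fmap F (hom_of_eq p) = hom_of_eq (congr1 F p).
Proof. by case: B / p; apply: fmap_id. Qed.

(** By extensionality the object maps become the same function; naturality then
    identifies the morphism maps, and the functor laws are propositions. *)
Lemma functor_eq (C D : category) (F G : functor C D)
    (p : forall A : C, F A = G A) :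
  (forall (A B : C) (f : hom A B),
     hom_of_eq (p B) • fmap F f = fmap G f • hom_of_eq (p A)) ->
  F = G.
Proof.
case: F p => F0 F1 F1_id F1_comp; case: G => G0 G1 G1_id G1_comp /= p natp.
have eq0 : F0 = G0 by apply: functional_extensionality.
subst G0.
have eq1 : F1 = G1.
  apply: functional_extensionality_dep => A.
  apply: functional_extensionality_dep => B.
  apply: functional_extensionality => f; have := natp _ _ f.
  (* Equalities of objects have unique proofs, so both transports vanish. *)
  by rewrite !(proof_irrelevance _ (p _) erefl) comp_idl comp_idr.
subst G1; congr Functor; exact: proof_irrelevance.
Qed.

(** The inverse [G] acts on morphisms by conjugating with the equalities
    [F (G B) = B] and then lifting through the full and faithful [F]. *)
Lemma automorphism_of_bijective_on_objects (C : category) (F : functor C C) :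
  full F -> faithful F ->
  (forall A B : C, F A = F B -> A = B) ->
  (forall B : C, exists A : C, F A = B) ->
  is_automorphism F.
Proof.
move=> fullF faithF injF /dependent_functional_choice [G0 p].
pose G1_spec A B f (s : hom (G0 A) (G0 B)) :=
  fmap F s = hom_of_eq (esym (p B)) • f • hom_of_eq (p A).
have /constructive_indefinite_description [G1 FG1] :
    exists G1 : forall A B : C, hom A B -> hom (G0 A) (G0 B),
      forall A B f, G1_spec A B f (G1 A B f).
  have [|G1 G1P] := @dependent_functional_choice C
    (fun A => forall B, hom A B -> hom (G0 A) (G0 B))
    (fun A G1 => forall B f, G1_spec A B f (G1 B f)); last by exists G1.
  move=> A; have [|G1 G1P] := @dependent_functional_choice C
    (fun B => hom A B -> hom (G0 A) (G0 B))
    (fun B G1 => forall f, G1_spec A B f (G1 f)); last by exists G1.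
  move=> B; have [|G1 G1P] := @dependent_functional_choice (hom A B)
    (fun _ => hom (G0 A) (G0 B)) (G1_spec A B); last by exists G1.
  by move=> f; apply: fullF.
rewrite /G1_spec in FG1.
have G1_id A : G1 A A (idmap A) = idmap (G0 A).
  by apply: faithF; rewrite FG1 fmap_id comp_idr hom_of_eqK.
have G1_comp A B D g f : G1 A D (g • f) = G1 B D g • G1 A B f.
  apply: faithF; rewrite fmap_comp !FG1 -!comp_assoc.
  by rewrite (comp_assoc (hom_of_eq (p B))) hom_of_eqVK comp_idl.
pose G := Functor G1_id G1_comp; exists G; split.
  apply: (@functor_eq _ _ (comp_functor G F) (id_functor C)
    (fun A => injF _ _ (p (F A)))) => A B f /=.
  apply: faithF; rewrite !fmap_comp FG1 !fmap_hom_of_eq.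
  rewrite !(proof_irrelevance _ (congr1 F _) (p (F _))).
  by rewrite !comp_assoc hom_of_eqVK comp_idl.
apply: (@functor_eq _ _ (comp_functor F G) (id_functor C) p) => A B f /=.
by rewrite FG1 !comp_assoc hom_of_eqVK comp_idl.
Qed.

(** * Conjugating a functor by isomorphisms *)

Section Conjugation.

Variables (C D : category) (P : functor C D) (F0 : C -> D).
Variables (v : forall A : C, hom (F0 A) (P A)).
Variables (v' : forall A : C, hom (P A) (F0 A)).
Hypotheses (vK : forall A, v' A • v A = idmap (F0 A)).
Hypotheses (v'K : forall A, v A • v' A = idmap (P A)).

Let F1 (A B : C) (f : hom A B) : hom (F0 A) (F0 B) := v' B • fmap P f • v A.

Lemma conjugate_id (A : C) : F1 (idmap A) = idmap (F0 A).
Proof. by rewrite /F1 fmap_id comp_idr. Qed.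

Lemma conjugate_comp (A B E : C) (g : hom B E) (f : hom A B) :
  F1 (g • f) = F1 g • F1 f.
Proof.
by rewrite /F1 fmap_comp -!comp_assoc (comp_assoc (v B)) v'K comp_idl.
Qed.

Definition conjugate_functor : functor C D :=
  Functor conjugate_id conjugate_comp.

Lemma conjugate_natural (A B : C) (f : hom A B) :
  v B • fmap conjugate_functor f = fmap P f • v A.
Proof. by rewrite /= /F1 !comp_assoc v'K comp_idl. Qed.

Lemma conjugate_isomorphic : isomorphic_functors P conjugate_functor.
Proof.
exists v'; split=> [A|A B f]; first by exists (v A).
by rewrite /= /F1 -comp_assoc v'K comp_idr.
Qed.

Lemma conjugate_full : full P -> full conjugate_functor.
Proof.
move=> fullP A B h; have [f Pf] := fullP _ _ (v B • h • v' A); exists f.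
by rewrite /= /F1 Pf !comp_assoc vK comp_idl -comp_assoc vK comp_idr.
Qed.

Lemma conjugate_faithful : faithful P -> faithful conjugate_functor.
Proof.
move=> faithP A B f g eqF; apply: faithP.
rewrite -[fmap P f]comp_idr -[fmap P g]comp_idr -v'K !comp_assoc.
by rewrite -!conjugate_natural eqF.
Qed.

Lemma conjugate_essentially_surjective :
  essentially_surjective P -> essentially_surjective conjugate_functor.
Proof.
move=> surjP B; have [A [g g_iso]] := surjP B.
by exists A, (g • v A); apply: is_iso_comp g_iso _; exists (v' A).
Qed.

End Conjugation.

(** * Morphisms over identity maps *)

Definition cast (X Y : Type) (e : X = Y) : X -> Y := ecast Z (X -> Z) e id.

Lemma castK (X Y : Type) (e : X = Y) : cancel (cast e) (cast (esym e)).
Proof. by case: Y / e. Qed.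

Lemma castVK (X Y : Type) (e : X = Y) : cancel (cast (esym e)) (cast e).
Proof. by case: Y / e. Qed.

Lemma cast_trans (X Y Z : Type) (e : X = Y) (e' : Y = Z) (x : X) :
  cast e' (cast e x) = cast (etrans e e') x.
Proof. by case: Z / e'. Qed.

(** The transported equation in [lifts], stated pointwise so that it can be
    used for rewriting. *)
Lemma liftsP (C : category) (Q : functor C Sets) (A B C' : C)
    (u : Q A -> Q B) (v : hom C' B) :
  lifts u v <-> exists e : Q C' = Q A, forall x, fmap Q v x = u (cast e x).
Proof.
split=> -[e eq_u]; exists e; move: u eq_u; case: _ / e => u.
  by move=> <-.
by move=> eq_u; apply: functional_extensionality.
Qed.

Lemma fmap_hom_of_eq_cast (C : category) (Q : functor C Sets) (A B : C)
    (p : A = B) (x : Q A) :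
  fmap Q (hom_of_eq p) x = cast (congr1 Q p) x.
Proof. by case: B / p; rewrite fmap_id. Qed.

Lemma bijective_fmap (C : category) (Q : functor C Sets) (A B : C)
    (f : hom A B) :
  is_iso f -> bijective (fmap Q f).
Proof.
move=> [g [gf fg]]; exists (fmap Q g) => x.
  by have /(congr1 (@^~ x)) := fmap_comp Q g f; rewrite gf fmap_id.
by have /(congr1 (@^~ x)) := fmap_comp Q f g; rewrite fg fmap_id.
Qed.

(** Both [A], through [f], and [B], through its identity, lift the identity
    bijection of [Q B]. *)
Lemma eq_of_iso_over_identity (C : category) (Q : functor C Sets) (A B : C)
    (f : hom A B) (e : Q A = Q B) :
  lifts_bijections Q -> is_iso f -> (forall x, fmap Q f x = cast e x) -> A = B.
Proof.
move=> liftQ f_iso Qf.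
have id_bij : bijective (@id (Q B)) by exists id.
have [D [_ uniqD]] := liftQ B B (ex_intro _ _ id_bij) _ id_bij.
rewrite -(uniqD A); first apply: uniqD.
  exists (idmap B); split; first exact: is_iso_id.
  by apply/liftsP; exists erefl => x; rewrite fmap_id.
by exists f; split=> //; apply/liftsP; exists e.
Qed.

(** Leaving [e] arbitrary, rather than requiring the composite of [Q] and [F] to
    equal [Q] as functors, is what pointwise choice of the objects [F A]
    provides. *)
Section OverIdentity.

Variables (C : category) (Q : functor C Sets) (F : functor C C).
Hypothesis Q_lifts : lifts_bijections Q.
Variable e : forall A : C, Q (F A) = Q A.
Hypothesis Q_F : forall (A B : C) (f : hom A B) (x : Q (F A)),
  cast (e B) (fmap Q (fmap F f) x) = fmap Q f (cast (e A) x).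

Lemma over_identity_injective (A B : C) :
  full F -> faithful F -> F A = F B -> A = B.
Proof.
move=> fullF faithF p; have [f Ff] := fullF _ _ (hom_of_eq p).
apply: (@eq_of_iso_over_identity _ Q _ _ f
  (etrans (esym (e A)) (etrans (congr1 Q p) (e B)))) => // [|x].
  by apply: (is_iso_reflect fullF faithF); rewrite Ff; apply: is_iso_hom_of_eq.
rewrite -[in LHS](castVK (e A) x) -Q_F Ff fmap_hom_of_eq_cast.
by rewrite !cast_trans.
Qed.

Lemma over_identity_surjective (B : C) :
  essentially_surjective F -> exists A : C, F A = B.
Proof.
move=> surjF; have [A [w w_iso]] := surjF B.
have [q wq qw] := bijective_fmap Q w_iso.
pose relabel (y : Q B) : Q A := cast (e A) (q y).
have relabel_bij : bijective relabel.
  exists (fun x => fmap Q w (cast (esym (e A)) x)) => x.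
    by rewrite castK qw.
  by rewrite /relabel wq castVK.
(* [c : A' -> A] lies over [relabel], the inverse of the map under [w]. *)
have [A' [[c [c_iso /liftsP [e' Qc]]] _]] :=
  Q_lifts (ex_intro _ relabel relabel_bij) relabel_bij.
exists A'.
apply: (@eq_of_iso_over_identity _ Q _ _ (w • fmap F c) (etrans (e A') e')).
- by [].
- exact: is_iso_comp w_iso (is_iso_fmap F c_iso).
move=> x; rewrite fmap_comp /= -[fmap Q (fmap F c) x](castK (e A)) Q_F Qc.
by rewrite castK qw cast_trans.
Qed.

End OverIdentity.

Theorem theorem4 (C : category) (Q : functor C Sets)
  (Q_faithful : faithful Q) (Q_lifts : lifts_bijections Q)
  (pi : functor C C) (pi_autoequivalence : is_autoequivalence pi)
  (pi_bijections : exists u : forall A : C, Q A -> Q (pi A),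
     (forall A : C, bijective (u A)) /\
     (forall (A B : C) (f : hom A B),
        fmap Q (fmap pi f) \o u A = u B \o fmap Q f)) :
  exists F : functor C C, is_automorphism F /\ isomorphic_functors pi F.
Proof.
have [u [u_bij u_nat]] := pi_bijections.
have [fullpi faithpi surjpi] := pi_autoequivalence.
have /dependent_functional_choice [F0 F0P] (A : C) :
    exists F0 : C, exists v : hom F0 (pi A), is_iso v /\ lifts (u A) v.
  have [F0 [F0P _]] := Q_lifts _ _ (ex_intro _ _ (u_bij A)) _ (u_bij A).
  by exists F0.
have [v vP] := dependent_functional_choice F0P.
have [v' v'P] := dependent_functional_choice (fun A => proj1 (vP A)).
have [e Qv] :=
  dependent_functional_choice (fun A => proj1 (liftsP _ _) (proj2 (vP A))).
have vK A := proj1 (v'P A); have v'K A := proj2 (v'P A).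
pose F := conjugate_functor vK v'K.
have fullF : full F by apply: conjugate_full.
have faithF : faithful F by apply: conjugate_faithful.
have surjF : essentially_surjective F.
  exact: conjugate_essentially_surjective.
have Q_F A B (f : hom A B) (x : Q (F A)) :
    cast (e B) (fmap Q (fmap F f) x) = fmap Q f (cast (e A) x).
  (* [u B] is injective, and after it both sides lie under the naturality
     square of [v]. *)
  apply: (bij_inj (u_bij B)); rewrite -Qv.
  have /(congr1 (fun h => fmap Q h x)) := conjugate_natural vK v'K f.
  rewrite !fmap_comp /= => ->; rewrite Qv.
  exact: (congr1 (@^~ (cast (e A) x)) (u_nat A B f)).
exists F; split; last exact: conjugate_isomorphic.
apply: automorphism_of_bijective_on_objects => // [A B|B].
  exact: (over_identity_injective Q_lifts Q_F fullF faithF).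
exact: (over_identity_surjective (F := F) Q_lifts Q_F B surjF).
Qed.
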